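(* Let $\mathcal{A}$ be a unital $C^*$-algebra and let $\mathcal{S}_1$ and $\mathcal{S}_2$ be two faithful operator $\mathcal{A}$-systems. Then their coproduct (denoted $\mathcal{S}_1\oplus_{\mathcal{A}}\mathcal{S}_2$) exists, it is a faithful operator $\mathcal{A}$-system, and it is unique up to a complete order isomorphism that is also an $\mathcal{A}$-bimodule map.
   Context: An operator system is a triple $(\mathcal{S},\{M_n(\mathcal{S})^+\}_{n},e)$ consisting of a matrix ordered $*$-vector space with an Archimedean matrix order unit $e$ (equivalently, by Choi–Effros, a unital selfadjoint subspace of some $B(H)$). ''Ucp'' means unital completely positive. A complete order isomorphism is a completely positive bijection with completely positive inverse. Let $\mathcal{A}$ be a unital $C^*$-algebra. An operator system $\mathcal{S}$ is an operator $\mathcal{A}$-system if it is a (unital) $\mathcal{A}$-bimodule such that $(a\cdot s)^*=s^*\cdot a^*$, $a\cdot e=e\cdot a$, and $[a_{ij}]\cdot[s_{ij}]\cdot[a_{ij}]^*\in M_n(\mathcal{S})^+$ for all $a\in\mathcal{A}$, $s\in\mathcal{S}$, $[a_{ij}]\in M_{n,m}(\mathcal{A})$, $[s_{ij}]\in M_m(\mathcal{S})^+$. It is faithful if $a\cdot e\neq 0$ for all $a\in\mathcal{A}\setminus\{0\}$. A linear map $\phi:\mathcal{S}\to\mathcal{T}$ between operator $\mathcal{A}$-systems is an $\mathcal{A}$-bimodule map if $\phi(a_1\cdot s\cdot a_2)=a_1\cdot\phi(s)\cdot a_2$ for all $a_1,a_2\in\mathcal{A}$, $s\in\mathcal{S}$.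 A coproduct of two operator $\mathcal{A}$-systems $\mathcal{S}_1,\mathcal{S}_2$ is their categorical coproduct for operator $\mathcal{A}$-systems and ucp $\mathcal{A}$-bimodule maps: an operator $\mathcal{A}$-system $X$ with ucp $\mathcal{A}$-bimodule maps $\phi_i:\mathcal{S}_i\to X$ ($i=1,2$) such that for every operator $\mathcal{A}$-system $\mathcal{R}$ and ucp $\mathcal{A}$-bimodule maps $\psi_i:\mathcal{S}_i\to\mathcal{R}$ ($i=1,2$) there is a unique ucp $\mathcal{A}$-bimodule map $\Psi:X\to\mathcal{R}$ with $\Psi\circ\phi_i=\psi_i$ for $i=1,2$. *)

(* Defs.v *)
From HB Require Import structures.
From mathcomp Require Import all_boot all_order all_algebra.
From mathcomp Require Import complex.
From mathcomp Require Import all_classical all_reals all_analysis.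

Set Implicit Arguments.
Unset Strict Implicit.
Unset Printing Implicit Defensive.

Import Order.TTheory GRing.Theory Num.Theory.
Import numFieldNormedType.Exports.

Local Open Scope classical_set_scope.
Local Open Scope ring_scope.

(** The complex numbers are [R[i]] for [R : realType]. Its order is partial, so
    [0 <= r] (resp. [0 < r]) for [r : R[i]] says that [r] is a nonnegative
    (resp. positive) real number; [c^*] is complex conjugation. *)

HB.mixin Record isStarModule (R : realType) V of GRing.Lmodule R[i] V := {
  star : V -> V ;
  starD : {morph star : x y / x + y} ;
  starZ : forall (c : R[i]) (x : V), star (c *: x) = c^* *: star x ;
  starK : involutive star
}.

#[short(type="starModType")]
HB.structure Definition StarModule (R : realType) :=
  { V of isStarModule R V & GRing.Lmodule R[i] V }.

(** [algType] requires [1 != 0]: the zero algebra is excluded. The norm is a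
    field of its own because the ring structures and the normed modules of the
    library have no common refinement; [normc] is the real-valued modulus. *)
HB.mixin Record isCStarAlgebra (R : realType) A
    of StarModule R A & GRing.Algebra R[i] A := {
  starM : forall a b : A, star (a * b) = star b * star a ;
  cnorm : A -> R ;
  cnorm_eq0 : forall a : A, cnorm a = 0 -> a = 0 ;
  cnormD : forall a b : A, cnorm (a + b) <= cnorm a + cnorm b ;
  cnormZ : forall (c : R[i]) (a : A),
    cnorm (c *: a) = Normc.normc c * cnorm a ;
  cnormM : forall a b : A, cnorm (a * b) <= cnorm a * cnorm b ;
  cnorm_cstar : forall a : A, cnorm (star a * a) = cnorm a ^+ 2 ;
  cnorm_complete : forall u : nat -> A,
    (forall eps : R, 0 < eps -> exists N : nat, forall m n : nat,
      (N <= m)%N -> (N <= n)%N -> cnorm (u m - u n) < eps) ->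
    exists l : A, cnorm (u n - l) @[n --> \oo] --> (0 : R)
}.

#[short(type="cstarAlgType")]
HB.structure Definition CStarAlgebra (R : realType) :=
  { A of isCStarAlgebra R A & StarModule R A & GRing.Algebra R[i] A }.

Definition mxstar (R : realType) (V : starModType R) m n (s : 'M[V]_(m, n)) :
  'M[V]_(n, m) := map_mx star s^T.

(** [cone n] is the set of positive elements of [M_n(S)]. The matrix level
    [n = 0] is allowed and harmless: ['M_0] has a single element, and it is
    positive by [order_unit]. The matrix [(r *: unit_elt)%:M] is [r e_n]. *)
HB.mixin Record isOperatorSystem (R : realType) S of StarModule R S := {
  cone : forall n : nat, set 'M[S]_n ;
  unit_elt : S ;
  cone_herm : forall n (s : 'M[S]_n), cone n s -> mxstar s = s ;
  coneD : forall n (s t : 'M[S]_n), cone n s -> cone n t -> cone n (s + t) ;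
  coneZ : forall n (r : R[i]) (s : 'M[S]_n),
    0 <= r -> cone n s -> cone n (map_mx ( *:%R r) s) ;
  cone_proper : forall n (s : 'M[S]_n), cone n s -> cone n (- s) -> s = 0 ;
  (* the matrix is X s X^* *)
  cone_conj : forall n m (X : 'M[R[i]]_(n, m)) (s : 'M[S]_m), cone m s ->
    cone n (\matrix_(i, j) \sum_k \sum_l (X i k * (X j l)^*) *: s k l) ;
  unit_elt_herm : star unit_elt = unit_elt ;
  order_unit : forall n (s : 'M[S]_n), mxstar s = s ->
    exists2 r : R[i], 0 < r & cone n ((r *: unit_elt)%:M - s) ;
  archimedean : forall n (s : 'M[S]_n),
    (forall r : R[i], 0 < r -> cone n ((r *: unit_elt)%:M + s)) -> cone n s
}.

#[short(type="operatorSystemType")]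
HB.structure Definition OperatorSystem (R : realType) :=
  { S of isOperatorSystem R S & StarModule R S }.

(** [lact a s] is [a . s] and [ract s a] is [s . a]; the actions are bilinear
    over the complex numbers, as is part of being a bimodule over an algebra. *)
HB.mixin Record isOperatorASystem (R : realType) (A : cstarAlgType R) S
    of OperatorSystem R S := {
  lact : A -> S -> S ;
  ract : S -> A -> S ;
  lactDl : forall (a b : A) (s : S), lact (a + b) s = lact a s + lact b s ;
  lactDr : forall (a : A) (s t : S), lact a (s + t) = lact a s + lact a t ;
  lactZl : forall (c : R[i]) (a : A) (s : S), lact (c *: a) s = c *: lact a s ;
  lactZr : forall (c : R[i]) (a : A) (s : S), lact a (c *: s) = c *: lact a s ;
  lactA : forall (a b : A) (s : S), lact (a * b) s = lact a (lact b s) ;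
  lact1 : forall s : S, lact 1 s = s ;
  ractDl : forall (s t : S) (a : A), ract (s + t) a = ract s a + ract t a ;
  ractDr : forall (s : S) (a b : A), ract s (a + b) = ract s a + ract s b ;
  ractZl : forall (c : R[i]) (s : S) (a : A), ract (c *: s) a = c *: ract s a ;
  ractZr : forall (c : R[i]) (s : S) (a : A), ract s (c *: a) = c *: ract s a ;
  ractA : forall (s : S) (a b : A), ract s (a * b) = ract (ract s a) b ;
  ract1 : forall s : S, ract s 1 = s ;
  lact_ract : forall (a : A) (s : S) (b : A),
    lact a (ract s b) = ract (lact a s) b ;
  star_lact : forall (a : A) (s : S), star (lact a s) = ract (star s) (star a) ;
  lact_unit : forall a : A, lact a unit_elt = ract unit_elt a ;
  (* the matrix is X . s . X^* *)
  cone_lact : forall n m (X : 'M[A]_(n, m)) (s : 'M[S]_m), cone m s ->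
    cone n (\matrix_(i, j) \sum_k \sum_l
      ract (lact (X i k) (s k l)) (star (X j l)))
}.

#[short(type="operatorASystemType")]
HB.structure Definition OperatorASystem (R : realType) (A : cstarAlgType R) :=
  { S of isOperatorASystem R A S & OperatorSystem R S }.

Definition faithful (R : realType) (A : cstarAlgType R)
    (S : operatorASystemType A) : Prop :=
  forall a : A, a != 0 -> lact a (unit_elt : S) != 0.

Definition completely_positive (R : realType) (S T : operatorSystemType R)
    (phi : S -> T) : Prop :=
  forall n (s : 'M[S]_n), cone n s -> cone n (map_mx phi s).

Definition ucp (R : realType) (S T : operatorSystemType R)
    (phi : {linear S -> T}) : Prop :=
  phi unit_elt = unit_elt /\ completely_positive phi.

Definition complete_order_iso (R : realType) (S T : operatorSystemType R)
    (phi : {linear S -> T}) : Prop :=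
  completely_positive phi /\
  exists psi : {linear T -> S},
    [/\ cancel phi psi, cancel psi phi & completely_positive psi].

Definition bimodule_map (R : realType) (A : cstarAlgType R)
    (S T : operatorASystemType A) (phi : S -> T) : Prop :=
  forall (a b : A) (s : S), phi (ract (lact a s) b) = ract (lact a (phi s)) b.

Definition ucp_bimodule_map (R : realType) (A : cstarAlgType R)
    (S T : operatorASystemType A) (phi : {linear S -> T}) : Prop :=
  ucp phi /\ bimodule_map phi.

Definition is_coproduct (R : realType) (A : cstarAlgType R)
    (S1 S2 X : operatorASystemType A)
    (phi1 : {linear S1 -> X}) (phi2 : {linear S2 -> X}) : Prop :=
  [/\ ucp_bimodule_map phi1, ucp_bimodule_map phi2 &
    forall (T : operatorASystemType A)
           (psi1 : {linear S1 -> T}) (psi2 : {linear S2 -> T}),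
      ucp_bimodule_map psi1 -> ucp_bimodule_map psi2 ->
      exists Psi : {linear X -> T},
        [/\ ucp_bimodule_map Psi, Psi \o phi1 =1 psi1, Psi \o phi2 =1 psi2 &
          forall Psi' : {linear X -> T},
            ucp_bimodule_map Psi' ->
            Psi' \o phi1 =1 psi1 -> Psi' \o phi2 =1 psi2 -> Psi' =1 Psi]].

(* Main.v *)
Require Import Defs.
From HB Require Import structures.
From mathcomp Require Import all_boot all_order all_algebra.
From mathcomp Require Import complex.
From mathcomp Require Import all_classical all_reals all_analysis.
From mathcomp Require Import generic_quotient ring_quotient.
From mathcomp Require Import ring lra.

Set Implicit Arguments.
Unset Strict Implicit.
Unset Printing Implicit Defensive.

Import Order.TTheory GRing.Theory Num.Theory.
Import numFieldNormedType.Exports.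

Local Open Scope ring_scope.

(** The coproduct is the amalgamated sum: the direct sum of the two systems, in
    which [(a e1, 0)] is identified with [(0, a e2)] for every [a] in [A].

    Existence. Let [J] be a selfadjoint sub-bimodule of an operator A-system
    [V]. Call a hermitian matrix [x] over [V] positive modulo [J] when, for every
    [eps > 0], some matrix [j] over [J] makes [x + eps e + j] positive. These
    cones satisfy all the axioms except properness, and dividing [V] by the
    elements that are null for them (a sub-bimodule containing [J], see [null])
    restores properness ([null_entries], [null_quot_cone]). The quotient
    [sysquot J] is an operator A-system through which every ucp bimodule map
    vanishing on [J] factors ([sysquot_lift]): by the Archimedean property, such
    a map sends a matrix that is positive modulo [J] to a positive one. Take
    [V = S1 (+) S2] with unit [(e1/2, e2/2)] and [J = {(a e1, - a e2)}]. Then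
    [(e1, 0)], [(0, e2)] and the unit have the same class, so both inclusions are
    unital, and two ucp bimodule maps [psi1], [psi2] induce the ucp map
    [(s, t) |-> psi1 s + psi2 t], which vanishes on [J] ([coprodP]).

    Faithfulness. Suppose [a e = 0] in the quotient and put [c = a^* a]. Positivity
    of [c] and of [- c] modulo [J] yields, for each [eps], elements [d] with
    [(c + eps/2 + d) e1 >= 0] and [(c + eps/2 - d) e2 >= 0], and similarly for
    [- c]. If the second inequality can be carried over to [S1], adding the two
    gives [(2c + eps) e1 >= 0], and likewise [(- 2c + eps) e1 >= 0]; hence
    [c e1 = 0], and [a = 0] because [S1] is faithful.

    Carrying an inequality from [S2] to [S1] is the C*-algebraic part: in a
    faithful operator A-system, [c e >= 0] forces [c = b^* b] for some [b] in [A]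
    ([faithful_pos]), and [b^* b e1 >= 0] holds in every operator A-system. This
    needs a modulus [k = |c|] that is itself a square, [k = r^2]. Then
    [(k - c) c (k - c) = - (r (k - c))^2], so the square [(r (k - c))^2]
    annihilates [e]; by faithfulness [k (k - c) = 0], which gives [c = k = r^2].
    The modulus comes from square roots of [1 - h] for hermitian [h] of norm at
    most 1 ([sqrt_one_sub]), without spectral theory.

    Any other coproduct has a ucp bimodule map to this one, so it is faithful
    too, and two coproducts are isomorphic by the usual argument. *)

(** * Norm and involution *)

Section StarModuleTheory.
Variables (R : realType) (V : starModType R).
Implicit Types x y : V.

Lemma star0 : star 0 = 0 :> V.
Proof. by apply: (addrI (star 0)); rewrite -starD !addr0. Qed.

Lemma starN x : star (- x) = - star x.
Proof. by apply: (addrI (star x)); rewrite -starD !subrr star0. Qed.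

Lemma starB x y : star (x - y) = star x - star y.
Proof. by rewrite starD starN. Qed.

End StarModuleTheory.

Lemma scale_half_double (F : numFieldType) (V : lmodType F) (v : V) :
  2^-1 *: (v + v) = v.
Proof. by rewrite -mulr2n -[v *+ 2]scaler_nat scalerA mulVf ?pnatr_eq0// scale1r. Qed.

Lemma sub_half (F : numFieldType) (V : lmodType F) (v : V) :
  v - 2^-1 *: v = 2^-1 *: v.
Proof. by rewrite -{1}[v]scale_half_double scalerDr addrK. Qed.

Section CStarAlgebraTheory.
Variables (R : realType) (A : cstarAlgType R).
Implicit Types a b c h x y : A.

Lemma star1 : star 1 = 1 :> A.
Proof. by have := starM (star 1) (1 : A); rewrite !mulr1 starK mulr1. Qed.

Lemma cnorm0 : cnorm (0 : A) = 0.
Proof. by rewrite -(scale0r (0 : A)) cnormZ Normc.normc0 mul0r. Qed.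

Lemma cnormN a : cnorm (- a) = cnorm a.
Proof.
by rewrite -scaleN1r cnormZ /Normc.normc /= oppr0 sqrrN expr1n expr0n addr0 sqrtr1 mul1r.
Qed.

Lemma cnormB a b : cnorm (a - b) <= cnorm a + cnorm b.
Proof. by rewrite (le_trans (cnormD _ _))// cnormN. Qed.

Lemma cnormBC a b : cnorm (a - b) = cnorm (b - a).
Proof. by rewrite -cnormN opprB. Qed.

Lemma cnorm_distD c a b : cnorm (a - b) <= cnorm (a - c) + cnorm (c - b).
Proof. by rewrite -(subrKA c) cnormD. Qed.

Lemma cnorm_ge0 a : 0 <= cnorm a.
Proof. have := cnormB a a; rewrite subrr cnorm0; lra. Qed.

Lemma cnorm_star a : cnorm (star a) = cnorm a.
Proof.
suff le_star b : cnorm b <= cnorm (star b).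
  by apply/eqP; rewrite eq_le le_star -{2}[a]starK le_star.
have [b0|b_neq0] := eqVneq (cnorm b) 0; first by rewrite b0 cnorm_ge0.
have b_gt0 : 0 < cnorm b by rewrite lt_neqAle eq_sym b_neq0 cnorm_ge0.
by rewrite -(ler_pM2r b_gt0) -expr2 -cnorm_cstar cnormM.
Qed.

Lemma starM_eq0 a : star a * a = 0 -> a = 0.
Proof.
by move=> a0; apply/cnorm_eq0/eqP; rewrite -sqrf_eq0 -cnorm_cstar a0 cnorm0.
Qed.

Lemma cnorm_sqr_herm h : star h = h -> cnorm (h * h) = cnorm h ^+ 2.
Proof. by move=> hh; rewrite -cnorm_cstar hh. Qed.

Lemma cnorm1 : cnorm (1 : A) = 1.
Proof.
have : cnorm (1 : A) != 0.
  by apply/eqP => /cnorm_eq0/eqP; rewrite oner_eq0.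
move=> n0; apply: (mulfI n0).
by rewrite mulr1 -expr2 -cnorm_sqr_herm ?star1// mulr1.
Qed.

Lemma cnorm_half a : cnorm (2^-1 *: a) = 2^-1 * cnorm a.
Proof.
rewrite cnormZ; congr (_ * _).
rewrite Normc.normcV; congr (_^-1).
by rewrite /Normc.normc /= addr0 expr0n addr0 sqrtr_sqr ger0_norm.
Qed.

Lemma cnorm_eq0_small (K : R) a :
  (forall eps, 0 < eps -> cnorm a <= K * eps) -> a = 0.
Proof.
move=> aK; apply: cnorm_eq0; apply/eqP; rewrite eq_le cnorm_ge0 andbT.
apply/ler_addgt0Pr => eps eps0; rewrite add0r.
have K0 : 0 < `|K| + 1 by rewrite ltr_pwDr.
have := aK _ (divr_gt0 eps0 K0) => /le_trans; apply.
rewrite mulrA ler_pdivrMr// mulrC ler_pM2l// (le_trans (ler_norm _))//.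
by rewrite lerDl.
Qed.

(** * Square roots in a C*-algebra *)

Section SquareRoot.
Local Open Scope classical_set_scope.
Variable h : A.
Hypothesis h_le1 : cnorm h <= 1.

(** The fixed-point iteration of [y = (h + y^2) / 2], an equation that says
    [(1 - y)^2 = 1 - h]. *)
Fixpoint picard n : A :=
  if n is n'.+1 then 2^-1 *: (h + picard n' * picard n') else 0.

(** The same iteration for [h = 1] in the real numbers. It increases and stays
    below 1, and its steps dominate those of [picard] in norm, even when the
    norm of [h] is 1 and the iteration is not a contraction. *)
Fixpoint scalar_picard n : R :=
  if n is n'.+1 then 2^-1 * (1 + scalar_picard n' ^+ 2) else 0.

Local Notation y_ := picard.
Local Notation t_ := scalar_picard.

Lemma scalar_picard_bounds n : 0 <= t_ n <= 1.
Proof. by elim: n => [|n /andP[t0 t1]] /=; [lra|nra]. Qed.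

Lemma scalar_picard_step n : t_ n <= t_ n.+1.
Proof. have /= := scalar_picard_bounds n; nra. Qed.

Lemma scalar_picard_cauchy (eps : R) : 0 < eps ->
  exists N, forall m n, (N <= m)%N -> (N <= n)%N -> `|t_ m - t_ n| < eps.
Proof.
move=> eps0.
have nd : nondecreasing_seq t_ by apply/nondecreasing_seqP/scalar_picard_step.
have ub : has_ubound (range t_).
  by exists 1 => _ [n _ <-]; case/andP: (scalar_picard_bounds n).
have /cvgrPdist_lt := nondecreasing_cvgn nd ub.
have e2 : 0 < eps / 2 by lra.
move=> /(_ _ e2) [N _ tN]; exists N => m n /tN /= tm /tN /= tn.
have := ler_distD (sup (range t_)) (t_ m) (t_ n).
by rewrite [`|t_ m - sup _|]distrC; move: tm tn; lra.
Qed.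

Lemma picard_le n : cnorm (y_ n) <= t_ n.
Proof.
elim: n => [|n IHn]; first by rewrite cnorm0.
rewrite /= cnorm_half ler_pM2l ?invr_gt0//.
rewrite (le_trans (cnormD _ _))// lerD// (le_trans (cnormM _ _))//.
by rewrite expr2 ler_pM ?cnorm_ge0.
Qed.

Lemma sqr_sub_cnorm (x y : A) :
  cnorm (x * x - y * y) <= (cnorm x + cnorm y) * cnorm (x - y).
Proof.
have -> : x * x - y * y = x * (x - y) + (x - y) * y.
  by rewrite mulrBr mulrBl addrA subrK.
rewrite (le_trans (cnormD _ _))// [leRHS]mulrDl lerD ?cnormM//.
by rewrite [leRHS]mulrC cnormM.
Qed.

(** Both sides obey the recurrence obtained by factoring a difference of two
    squares, and the iterates themselves are bounded by the scalar ones. *)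
Lemma picard_step_le n : cnorm (y_ n.+1 - y_ n) <= t_ n.+1 - t_ n.
Proof.
elim: n => [|n IHn]; first by rewrite subr0 subr0 (le_trans (picard_le 1)).
have -> : y_ n.+2 - y_ n.+1 = 2^-1 *: (y_ n.+1 * y_ n.+1 - y_ n * y_ n).
  have yS k : y_ k.+1 = 2^-1 *: (h + y_ k * y_ k) by [].
  by rewrite (yS n.+1) [X in _ - X = _]yS -scalerBr opprD addrACA subrr add0r.
have -> : t_ n.+2 - t_ n.+1 = 2^-1 * ((t_ n.+1 + t_ n) * (t_ n.+1 - t_ n)).
  have tS k : t_ k.+1 = 2^-1 * (1 + t_ k ^+ 2) by [].
  by rewrite (tS n.+1) [X in _ - X = _]tS; ring.
rewrite cnorm_half ler_pM2l ?invr_gt0// (le_trans (sqr_sub_cnorm _ _))//.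
by rewrite ler_pM ?addr_ge0 ?cnorm_ge0// lerD ?picard_le.
Qed.

Lemma picard_dist_le m n : (m <= n)%N -> cnorm (y_ n - y_ m) <= t_ n - t_ m.
Proof.
move=> /subnK <-; elim: (n - m)%N => [|d IHd]; first by rewrite !subrr cnorm0.
rewrite addSn; have := cnorm_distD (y_ (d + m)) (y_ (d + m).+1) (y_ m).
by move: IHd (picard_step_le (d + m)); lra.
Qed.

Lemma picard_lim : exists y, forall eps, 0 < eps ->
  exists N, forall n, (N <= n)%N -> cnorm (y_ n - y) < eps.
Proof.
have [|y /cvgrPdist_lt yP] := @cnorm_complete _ _ y_.
  move=> eps /scalar_picard_cauchy[N tN]; exists N => m n Nm Nn.
  have := tN _ _ Nm Nn.
  wlog le_mn : m n Nm Nn / (n <= m)%N => [wlog_mn|].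
    have [/wlog_mn|/ltnW/wlog_mn] := leqP n m; first exact.
    by rewrite cnormBC distrC; apply.
  by apply: le_lt_trans; rewrite (le_trans (picard_dist_le le_mn))// ler_norm.
exists y => eps /yP[N _ yN]; exists N => n /yN /=.
by rewrite sub0r normrN ger0_norm ?cnorm_ge0.
Qed.

Lemma picard_herm n : star h = h -> star (y_ n) = y_ n.
Proof.
move=> hh; elim: n => [|n IHn] /=; first exact: star0.
by rewrite starZ starD starM IHn hh fmorphV rmorph_nat.
Qed.

Lemma picard_comm n b : h * b = b * h -> y_ n * b = b * y_ n.
Proof.
move=> hb; elim: n => [|n IHn] /=; first by rewrite mul0r mulr0.
by rewrite -scalerAl -scalerAr mulrDl mulrDr hb -mulrA IHn mulrA IHn mulrA.
Qed.

(** The square root of [1 - h] is written [1 - y] with [y] of norm at most 1, so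
    that the result applies again to [1 - y]. *)
Lemma sqrt_one_sub : star h = h -> exists y,
  [/\ star y = y, cnorm y <= 1, (1 - y) * (1 - y) = 1 - h &
      forall b, h * b = b * h -> y * b = b * y].
Proof.
move=> hh; have [y yP] := picard_lim; exists y.
have near_y eps : 0 < eps -> exists n,
    cnorm (y_ n - y) < eps /\ cnorm (y_ n.+1 - y) < eps.
  by move=> /yP[N yN]; exists N; split; apply: yN => //.
have y_le1 n : cnorm (y_ n) <= 1.
  by have := picard_le n; have := scalar_picard_bounds n; lra.
have y1 : cnorm y <= 1.
  apply/ler_addgt0Pr => eps /near_y[n [yn _]].
  rewrite -(subKr (y_ n) y) (le_trans (cnormB _ _))//.
  by rewrite lerD// ltW.
split=> //.
- apply/eqP; rewrite -subr_eq0; apply/eqP.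
  apply: (@cnorm_eq0_small 2) => eps /near_y[n [yn _]].
  have := cnorm_distD (y_ n) (star y) y.
  have := cnorm_star (y - y_ n); rewrite starB picard_herm// => ->.
  by rewrite (cnormBC y); move: yn; lra.
- have -> : (1 - y) * (1 - y) = 1 - (y + y - y * y).
    by rewrite mulrBl mul1r mulrBr mulr1 -[X in _ = 1 - X]addrA [in RHS]opprD addrA.
  congr (1 - _); apply/eqP; rewrite -subr_eq0; apply/eqP.
  apply: (@cnorm_eq0_small 4) => eps /near_y[n [yn yn1]].
  have yS : h = y_ n.+1 + y_ n.+1 - y_ n * y_ n.
    by rewrite /= -scalerDr scale_half_double addrK.
  have -> : y + y - y * y - h = (y_ n * y_ n - y * y) - ((y_ n.+1 - y) + (y_ n.+1 - y)).
    rewrite [in LHS]yS opprB addrACA [in RHS]addrACA -[- y - y]opprD opprB.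
    by rewrite [in RHS]addrACA [in RHS](addrC (_ * _)).
  rewrite (le_trans (cnormB _ _))//.
  have := cnormD (y_ n.+1 - y) (y_ n.+1 - y).
  have := sqr_sub_cnorm (y_ n) y; have := y_le1 n.
  have := cnorm_ge0 (y_ n - y); have := cnorm_ge0 (y_ n); have := cnorm_ge0 y.
  nra.
- move=> b hb; apply/eqP; rewrite -subr_eq0; apply/eqP.
  apply: (@cnorm_eq0_small (2 * cnorm b)) => eps /near_y[n [yn _]].
  have -> : y * b - b * y = b * (y_ n - y) - (y_ n - y) * b.
    by rewrite mulrBr mulrBl (picard_comm n hb) opprB [RHS]addrC subrKA.
  rewrite (le_trans (cnormB _ _))//.
  have := cnormM b (y_ n - y); have := cnormM (y_ n - y) b.
  have := cnorm_ge0 (y_ n - y); have := cnorm_ge0 b.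
  nra.
Qed.
End SquareRoot.

(** The modulus of [c] is [r * r]. With [s] a square root of [1 - c^2], the
    element [u = c + i s] satisfies [u^* u = 1], so [s] is a contraction and
    [c^2 = 1 - s^2] has a square root [1 - z]; as [z] is again a contraction,
    [1 - z] has a square root in its turn. *)
Lemma herm_abs c : star c = c -> cnorm c <= 1 -> exists r : A,
  [/\ star r = r, r * r * (r * r) = c * c & r * c = c * r].
Proof.
move=> hc c_le1.
have cc_le1 : cnorm (c * c) <= 1.
  by rewrite cnorm_sqr_herm// expr_le1 ?cnorm_ge0.
have hcc : star (c * c) = c * c by rewrite starM hc.
have [y [hy _ y2 commy]] := sqrt_one_sub cc_le1 hcc.
set s := 1 - y in y2.
have hs : star s = s by rewrite starB star1 hy.
have sc : s * c = c * s.
  by rewrite mulrBl mulrBr mul1r mulr1 commy// mulrA.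
have ss_le1 : cnorm (s * s) <= 1.
  rewrite cnorm_sqr_herm// expr_le1 ?cnorm_ge0//.
  pose u := c + 'i *: s.
  have su : star u = c - 'i *: s.
    by rewrite starD starZ hc hs conjCi scaleNr.
  have uu : star u * u = 1.
    rewrite su mulrBl 2!mulrDr -!scalerAl -!scalerAr sc scalerA -['i * _]expr2.
    by rewrite sqrCi scaleN1r y2 opprB addrACA subrr addr0 addrC subrK.
  have u1 : cnorm u <= 1.
    by rewrite -(expr_le1 (n := 2)) ?cnorm_ge0// -cnorm_cstar uu cnorm1.
  (* The imaginary part of [u], bounded by the norm of [u]. *)
  have -> : s = 2^-1 *: ('i *: (star u - u)).
    rewrite su opprD addrACA subrr add0r scalerBr scalerN !scalerA -['i * _]expr2.
    by rewrite sqrCi scaleN1r opprK scale_half_double.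
  rewrite cnorm_half cnormZ.
  have -> : Normc.normc 'i = 1 :> R.
    by rewrite -complexiE /Normc.normc /= expr0n add0r expr1n sqrtr1.
  have := cnormB (star u) u; rewrite cnorm_star; lra.
have hss : star (s * s) = s * s by rewrite starM hs.
have [z [hz z1 z2 commz]] := sqrt_one_sub ss_le1 hss.
have [w [hw _ w2 commw]] := sqrt_one_sub z1 hz.
have zc : z * c = c * z.
  by apply: commz; rewrite -mulrA sc mulrA sc mulrA.
exists (1 - w); split.
- by rewrite starB star1 hw.
- by rewrite w2 z2 y2 subKr.
- by rewrite mulrBl mulrBr mul1r mulr1 commw.
Qed.
End CStarAlgebraTheory.

(** * Positive elements of a faithful operator A-system *)

Section FaithfulSystem.
Variables (R : realType) (A : cstarAlgType R) (S : operatorASystemType A).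
Implicit Types (a b c : A) (s t : S).

Definition pos s := cone 1 (s%:M : 'M[S]_1).

Lemma lact0l s : lact (0 : A) s = 0.
Proof. by apply: (addrI (lact (0 : A) s)); rewrite -lactDl !addr0. Qed.

Lemma lact0r a : lact a (0 : S) = 0.
Proof. by apply: (addrI (lact a 0)); rewrite -lactDr !addr0. Qed.

Lemma ract0l a : ract (0 : S) a = 0.
Proof. by apply: (addrI (ract 0 a)); rewrite -ractDl !addr0. Qed.

Lemma ract0r s : ract s (0 : A) = 0.
Proof. by apply: (addrI (ract s (0 : A))); rewrite -ractDr !addr0. Qed.

Lemma lactNl a s : lact (- a) s = - lact a s.
Proof. by apply: (addrI (lact a s)); rewrite -lactDl !subrr lact0l. Qed.

Lemma lactNr a s : lact a (- s) = - lact a s.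
Proof. by apply: (addrI (lact a s)); rewrite -lactDr !subrr lact0r. Qed.

Lemma ractNl s a : ract (- s) a = - ract s a.
Proof. by apply: (addrI (ract s a)); rewrite -ractDl !subrr ract0l. Qed.

Lemma star_ract s a : star (ract s a) = lact (star a) (star s).
Proof. by rewrite -{1}[s]starK -{1}[a]starK -star_lact starK. Qed.

Lemma pos_conj a s : pos s -> pos (ract (lact a s) (star a)).
Proof.
move=> /(cone_lact 1 1 a%:M _); congr (cone _ _); apply/matrixP => i j.
by rewrite !ord1 !mxE !big_ord1 !mxE /= !mulr1n.
Qed.

Lemma pos_unit : pos unit_elt.
Proof.
have [|r r0 /(@coneZ _ _ _ r^-1)] := @order_unit _ S 1 0.
  by apply/matrixP => i j; rewrite !mxE star0.
rewrite subr0 invr_ge0 ltW// => /(_ isT); congr (cone _ _); apply/matrixP => i j.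
by rewrite !ord1 !mxE /= !mulr1n scalerA mulVf ?gt_eqF// scale1r.
Qed.

Lemma pos_star_unit a : pos (lact (star a * a) unit_elt).
Proof. by have := pos_conj (star a) pos_unit; rewrite starK -lact_ract -lact_unit -lactA. Qed.

Lemma pos_eq0 s : pos s -> pos (- s) -> s = 0.
Proof.
rewrite /pos => s0 sN.
have /matrixP/(_ 0 0) : s%:M = 0 :> 'M[S]_1.
  by apply: cone_proper => //; rewrite -raddfN.
by rewrite !mxE.
Qed.

Lemma posZ (r : R[i]) s : 0 <= r -> pos s -> pos (r *: s).
Proof.
move=> r0 /(coneZ _ _ _ r0); congr (cone _ _); apply/matrixP => i j.
by rewrite !ord1 !mxE.
Qed.

Lemma posD s t : pos s -> pos t -> pos (s + t).
Proof. by move=> s0 t0; have := coneD _ _ _ s0 t0; rewrite -raddfD. Qed.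

Lemma pos_archimedean s :
  (forall r : R[i], 0 < r -> pos (r *: unit_elt + s)) -> pos s.
Proof. by move=> s0; apply: archimedean => r /s0; rewrite /pos raddfD. Qed.

Lemma pos_herm s : pos s -> star s = s.
Proof. by move=> /cone_herm/matrixP/(_ 0 0); rewrite !mxE. Qed.

Hypothesis faithfulS : faithful S.

Lemma faithful_eq0 a : lact a (unit_elt : S) = 0 -> a = 0.
Proof. by move=> a0; apply/eqP; apply: contra_eqT a0 => /faithfulS. Qed.

(** Positivity of [c . e] in one faithful operator A-system is a property of [c]
    alone: it makes [c] positive in the algebra. *)
Lemma faithful_pos c : pos (lact c (unit_elt : S)) -> exists b, c = star b * b.
Proof.
wlog c_le1 : c / cnorm c <= 1 => [wlog_c posc|].
  have k_gt0 : 0 < cnorm c + 1 by rewrite ltr_wpDl ?cnorm_ge0.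
  set k := cnorm c + 1 in k_gt0.
  have [||b cE] := wlog_c ((k^-1)%:C%C *: c).
  - rewrite cnormZ /Normc.normc /= expr0n addr0 sqrtr_sqr ger0_norm; last by rewrite invr_ge0 ltW.
    by rewrite mulrC ler_pdivrMr// mul1r lerDl.
  - by rewrite lactZl; apply: posZ; rewrite // ler0c invr_ge0 ltW.
  exists ((Num.sqrt k)%:C%C *: b).
  rewrite starZ conj_Creal ?ger0_real ?ler0c ?sqrtr_ge0//.
  rewrite -scalerAl -scalerAr -cE !scalerA -!rmorphM /= -expr2 sqr_sqrtr ?ltW//.
  by rewrite mulfV ?gt_eqF// scale1r.
move=> posc.
have hc : star c = c.
  apply/eqP; rewrite -subr_eq0; apply/eqP/faithful_eq0.
  rewrite lactDl lactNl; apply/eqP; rewrite subr_eq0; apply/eqP.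
  by rewrite -[RHS]pos_herm// star_lact unit_elt_herm -lact_unit.
have [r [hr r4 rc]] := herm_abs hc c_le1.
set k := r * r in r4.
have hk : star k = k by rewrite starM hr.
have kc : k * c = c * k by rewrite -mulrA rc mulrA rc mulrA.
exists r; rewrite hr.
(* [k - c] is twice the negative part of [c]. Conjugating [c] by it gives
   [- x^* x], so [x^* x] acts on the unit both positively and negatively. *)
pose x := r * (k - c).
have hx : star x * x = - ((k - c) * c * (k - c)).
  rewrite starM hr starB hk hc mulrA -[_ * r * r]mulrA -/k.
  apply/eqP; rewrite -addr_eq0 -mulrDl -mulrDr mulrBl !mulrDr r4 kc.
  by rewrite [X in X - _]addrC subrr !mul0r addr0.
have x0 : x = 0.
  apply: starM_eq0; apply: faithful_eq0; apply: pos_eq0.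
    exact: pos_star_unit.
  rewrite -lactNl hx opprK.
  have := pos_conj (k - c) posc.
  rewrite starB hk hc -lactA -lact_ract -lact_unit.
  by rewrite -lactA.
apply/esym/eqP; rewrite -subr_eq0; apply/eqP.
apply: starM_eq0; rewrite starB -/k hk hc.
(* Here [(k - c)^2 = 2 k (k - c)], as [k^2 = c^2]. *)
have kx : k * k - k * c = 0 by rewrite -mulrBr -mulrA -/x x0 mulr0.
by rewrite mulrBl !mulrBr kx sub0r -r4 -kc opprB kx.
Qed.
End FaithfulSystem.

(** * Matrices over a bimodule *)

Section MatrixStar.
Variables (R : realType) (V : starModType R).

Lemma mxstarD m n (x y : 'M[V]_(m, n)) : mxstar (x + y) = mxstar x + mxstar y.
Proof. by apply/matrixP => i j; rewrite !mxE starD. Qed.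

Lemma mxstarN m n (x : 'M[V]_(m, n)) : mxstar (- x) = - mxstar x.
Proof. by apply/matrixP => i j; rewrite !mxE starN. Qed.

Lemma mxstar0 m n : mxstar (0 : 'M[V]_(m, n)) = 0.
Proof. by apply/matrixP => i j; rewrite !mxE star0. Qed.

Lemma mxstarK m n (x : 'M[V]_(m, n)) : mxstar (mxstar x) = x.
Proof. by apply/matrixP => i j; rewrite !mxE starK. Qed.

Lemma mxstar_scale m n (r : R[i]) (x : 'M[V]_(m, n)) : 0 <= r ->
  mxstar (map_mx ( *:%R r) x) = map_mx ( *:%R r) (mxstar x).
Proof.
by move=> r0; apply/matrixP => i j; rewrite !mxE starZ conj_Creal ?ger0_real.
Qed.

Definition emx m n (i : 'I_m) (j : 'I_n) (x : V) : 'M[V]_(m, n) :=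
  \matrix_(k, l) if (k == i) && (l == j) then x else 0.

Lemma emxD m n (i : 'I_m) (j : 'I_n) x y : emx i j (x + y) = emx i j x + emx i j y.
Proof. by apply/matrixP => k l; rewrite !mxE; case: ifP; rewrite ?addr0. Qed.

Lemma emx0 m n (i : 'I_m) (j : 'I_n) : emx i j 0 = 0.
Proof. by apply/matrixP => k l; rewrite !mxE; case: ifP. Qed.

Lemma mxstar_emx m n (i : 'I_m) (j : 'I_n) x : mxstar (emx i j x) = emx j i (star x).
Proof. by apply/matrixP => k l; rewrite !mxE andbC; case: ifP; rewrite ?star0. Qed.

Lemma mx_sum_emx m n (x : 'M[V]_(m, n)) : x = \sum_i \sum_j emx i j (x i j).
Proof.
apply/matrixP => k l; rewrite summxE (bigD1 k)//= summxE (bigD1 l)//= !mxE !eqxx.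
rewrite big1 ?addr0 => [|j /negPf ne]; last by rewrite mxE [l == j]eq_sym ne andbF.
rewrite big1 ?addr0// => i /negPf ne; rewrite summxE big1// => j _.
by rewrite mxE [k == i]eq_sym ne.
Qed.

(** For [i = j] this is twice the hermitian part of [x], on the diagonal. *)
Definition hpair n (i j : 'I_n) (x : V) : 'M[V]_n := emx i j x + emx j i (star x).

Lemma hpair_herm n (i j : 'I_n) x : mxstar (hpair i j x) = hpair i j x.
Proof. by rewrite mxstarD !mxstar_emx starK addrC. Qed.

Lemma hpairD n (i j : 'I_n) x y : hpair i j (x + y) = hpair i j x + hpair i j y.
Proof. by rewrite /hpair starD !emxD addrACA. Qed.

Lemma hpair0 n (i j : 'I_n) : hpair i j 0 = 0.
Proof. by rewrite /hpair star0 !emx0 addr0. Qed.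

Lemma hpairC n (i j : 'I_n) x : hpair i j (star x) = hpair j i x.
Proof. by rewrite /hpair starK addrC. Qed.

Lemma hermitian_sum_hpair n (x : 'M[V]_n) : mxstar x = x ->
  x = map_mx ( *:%R 2^-1) (\sum_i \sum_j hpair i j (x i j)).
Proof.
move=> hx; rewrite /hpair.
under eq_bigr do rewrite big_split /=.
rewrite big_split /= -mx_sum_emx exchange_big /=.
have -> : \sum_j \sum_i emx j i (star (x i j)) = x.
  rewrite [RHS]mx_sum_emx; apply: eq_bigr => i _; apply: eq_bigr => j _.
  by rewrite -[in RHS]hx !mxE.
by apply/matrixP => i j; rewrite !mxE scale_half_double.
Qed.

End MatrixStar.

Section Sandwich.
Variables (R : realType) (A : cstarAlgType R) (V : operatorASystemType A).
Implicit Types (a b : A) (x y : V).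

(** The matrix [X . s . Y^*]. Allowing [Y] to differ from [X] makes it biadditive
    in [X] and [Y], which reduces conjugations by sums to matrix units. *)
Definition sandwich m n (X Y : 'M[A]_(m, n)) (s : 'M[V]_n) : 'M[V]_m :=
  \matrix_(i, j) \sum_k \sum_l ract (lact (X i k) (s k l)) (star (Y j l)).

Lemma sandwichDl m n (X X' Y : 'M[A]_(m, n)) s :
  sandwich (X + X') Y s = sandwich X Y s + sandwich X' Y s.
Proof.
apply/matrixP => i j; rewrite !mxE -big_split /=; apply: eq_bigr => k _.
by rewrite -big_split /=; apply: eq_bigr => l _; rewrite !mxE lactDl ractDl.
Qed.

Lemma sandwichDr m n (X Y Y' : 'M[A]_(m, n)) s :
  sandwich X (Y + Y') s = sandwich X Y s + sandwich X Y' s.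
Proof.
apply/matrixP => i j; rewrite !mxE -big_split /=; apply: eq_bigr => k _.
by rewrite -big_split /=; apply: eq_bigr => l _; rewrite !mxE starD ractDr.
Qed.

Lemma sandwichDs m n (X Y : 'M[A]_(m, n)) s t :
  sandwich X Y (s + t) = sandwich X Y s + sandwich X Y t.
Proof.
apply/matrixP => i j; rewrite !mxE -big_split /=; apply: eq_bigr => k _.
by rewrite -big_split /=; apply: eq_bigr => l _; rewrite !mxE lactDr ractDl.
Qed.

Lemma sandwichN m n (X Y : 'M[A]_(m, n)) s : sandwich X Y (- s) = - sandwich X Y s.
Proof.
apply: (addrI (sandwich X Y s)); rewrite -sandwichDs !subrr.
apply/matrixP => i j; rewrite !mxE big1// => k _; rewrite big1// => l _.
by rewrite !mxE lact0r ract0l.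
Qed.

Lemma sandwich_scale m n (r : R[i]) (X Y : 'M[A]_(m, n)) s :
  sandwich X Y (map_mx ( *:%R r) s) = map_mx ( *:%R r) (sandwich X Y s).
Proof.
apply/matrixP => i j; rewrite !mxE scaler_sumr; apply: eq_bigr => k _.
by rewrite scaler_sumr; apply: eq_bigr => l _; rewrite !mxE lactZr ractZl.
Qed.

Lemma mxstar_sandwich m n (X Y : 'M[A]_(m, n)) s :
  mxstar (sandwich X Y s) = sandwich Y X (mxstar s).
Proof.
have star_sum I (r : seq I) (F : I -> V) : star (\sum_(i <- r) F i) = \sum_(i <- r) star (F i).
  exact: (big_morph _ (@starD _ V) (star0 V)).
apply/matrixP => i j; rewrite !mxE star_sum.
under eq_bigr do rewrite star_sum.
rewrite exchange_big /=.
by apply: eq_bigr => l _; apply: eq_bigr => k _; rewrite !mxE star_ract star_lact starK lact_ract.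
Qed.

Lemma sandwich_emx m n (p q : 'I_m) (i j : 'I_n) a b (s : 'M[V]_n) :
  sandwich (emx p i a) (emx q j b) s = emx p q (ract (lact a (s i j)) (star b)).
Proof.
apply/matrixP => k l; rewrite !mxE (bigD1 i)//= (bigD1 j)//= !mxE !eqxx !andbT.
rewrite !big1 ?addr0.
- by case: (k == p); case: (l == q); rewrite /= ?star0 ?lact0l ?ract0l ?ract0r.
- by move=> k' /negPf ne; rewrite big1// => l' _; rewrite !mxE ne andbF lact0l ract0l.
- by move=> l' /negPf ne; rewrite !mxE ne andbF star0 ract0r.
Qed.

Lemma cone_unit n (r : R[i]) : 0 <= r -> cone n ((r *: unit_elt)%:M : 'M[V]_n).
Proof.
have [|t t0] := @order_unit _ V n 0; first exact: mxstar0.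
rewrite subr0 => ct r0.
have := coneZ _ (r / t) _ (divr_ge0 r0 (ltW t0)) ct.
congr (cone _ _); apply/matrixP => i j; rewrite !mxE.
by case: eqP; rewrite ?mulr1n ?mulr0n ?scaler0// scalerA divfK ?gt_eqF.
Qed.

Lemma unit_mx_herm n (r : R[i]) : 0 <= r ->
  mxstar ((r *: unit_elt)%:M : 'M[V]_n) = (r *: unit_elt)%:M.
Proof. by move=> r0; apply/cone_herm/cone_unit. Qed.

Lemma cone0 n : cone n (0 : 'M[V]_n).
Proof.
have := cone_unit n (lexx 0); congr (cone _ _).
by rewrite scale0r raddf0.
Qed.

End Sandwich.

(** * Positivity modulo a sub-bimodule *)

Record subbimodule (R : realType) (A : cstarAlgType R)
    (V : operatorASystemType A) := SubBimodule {
  subbimod :> V -> Prop ;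
  subbimod0 : subbimod 0 ;
  subbimodD : forall x y, subbimod x -> subbimod y -> subbimod (x + y) ;
  subbimod_lact : forall a x, subbimod x -> subbimod (lact a x) ;
  subbimod_ract : forall x a, subbimod x -> subbimod (ract x a) ;
  subbimod_star : forall x, subbimod x -> subbimod (star x)
}.

Section QuotientCone.
Variables (R : realType) (A : cstarAlgType R) (V : operatorASystemType A).
Variable J : subbimodule V.
Implicit Types (a b : A) (x y : V).

Lemma subbimodN x : J x -> J (- x).
Proof. by move=> /(subbimod_lact (-1)); rewrite lactNl lact1. Qed.

Lemma subbimodZ (c : R[i]) x : J x -> J (c *: x).
Proof. by move=> /(subbimod_lact (c *: 1)); rewrite lactZl lact1. Qed.

Lemma subbimod_sum I (r : seq I) (F : I -> V) :
  (forall i, J (F i)) -> J (\sum_(i <- r) F i).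
Proof.
by move=> JF; apply: big_ind => //; [exact: subbimod0|exact: subbimodD].
Qed.

(** The perturbation by [eps] builds the Archimedean property into the cone, and
    the hermitian condition has to be imposed since [j] is arbitrary. *)
Definition quot_cone n (x : 'M[V]_n) : Prop :=
  mxstar x = x /\ forall eps : R[i], 0 < eps ->
    exists2 j : 'M[V]_n, forall k l, J (j k l) &
      cone n (x + (eps *: unit_elt)%:M + j).

Lemma quot_cone_of_cone n (x : 'M[V]_n) : cone n x -> quot_cone x.
Proof.
move=> cx; split=> [|eps eps0]; first exact: cone_herm.
exists 0 => [k l|]; first by rewrite mxE; exact: subbimod0.
by rewrite addr0; apply: coneD => //; apply/cone_unit/ltW.
Qed.

Lemma quot_coneD n (x y : 'M[V]_n) :
  quot_cone x -> quot_cone y -> quot_cone (x + y).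
Proof.
move=> [hx cx] [hy cy]; split=> [|eps eps0]; first by rewrite mxstarD hx hy.
have eps20 : 0 < eps / 2 by rewrite divr_gt0.
have [j Jj cxj] := cx _ eps20; have [k Jk cyk] := cy _ eps20.
exists (j + k) => [p q|]; first by rewrite mxE; apply: subbimodD.
have := coneD _ _ _ cxj cyk; congr (cone _ _).
rewrite addrACA; congr (_ + _); rewrite addrACA; congr (_ + _).
by rewrite -raddfD /= -scalerDl -splitr.
Qed.

(** Conjugation turns the perturbation [eps e] into [eps X . e . X^*], which an
    order unit bounds by a multiple of [e]. *)
Lemma quot_cone_sandwich m n (X : 'M[A]_(m, n)) (x : 'M[V]_n) :
  quot_cone x -> quot_cone (sandwich X X x).
Proof.
move=> [hx cx]; split=> [|eps eps0]; first by rewrite mxstar_sandwich hx.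
have [|r r0 cr] := @order_unit _ V _ (sandwich X X (1 *: unit_elt)%:M).
  by rewrite mxstar_sandwich unit_mx_herm.
have [j Jj cxj] := cx (eps / r) (divr_gt0 eps0 r0).
exists (sandwich X X j) => [k l|].
  rewrite mxE; apply: subbimod_sum => p; apply: subbimod_sum => q.
  by apply: subbimod_ract; apply: subbimod_lact.
have := coneD _ _ _ (cone_lact _ _ X _ cxj)
   (coneZ _ (eps / r) _ (ltW (divr_gt0 eps0 r0)) cr).
rewrite -/(sandwich X X _) !sandwichDs; congr (cone _ _).
have -> : ((eps / r) *: unit_elt)%:M =
    map_mx ( *:%R (eps / r)) (1 *: unit_elt)%:M :> 'M[V]_n.
  by apply/matrixP => k l; rewrite !mxE -scalerMnr scale1r.
rewrite sandwich_scale addrAC; congr (_ + _); rewrite -addrA; congr (_ + _).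
move: (sandwich X X _) => Z; apply/matrixP => k l; rewrite !mxE.
by rewrite scalerBr subrKC -scalerMnr scalerA divfK // lt0r_neq0.
Qed.

Lemma quot_coneZ n (r : R[i]) (x : 'M[V]_n) :
  0 <= r -> quot_cone x -> quot_cone (map_mx ( *:%R r) x).
Proof.
rewrite le_eqVlt => /predU1P[<- _|r0 [hx cx]].
  have := quot_cone_of_cone (cone0 V n); congr quot_cone.
  by apply/matrixP => i j; rewrite !mxE scale0r.
split=> [|eps eps0]; first by rewrite mxstar_scale ?ltW// hx.
have [j Jj cxj] := cx _ (divr_gt0 eps0 r0).
exists (map_mx ( *:%R r) j) => [k l|]; first by rewrite mxE; exact: subbimodZ.
have := coneZ _ _ _ (ltW r0) cxj; congr (cone _ _).
apply/matrixP => k l; rewrite !mxE !scalerDr; congr (_ + _ + _).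
by case: eqP; rewrite ?mulr1n ?mulr0n ?scaler0// scalerA mulrC divfK ?gt_eqF.
Qed.

Lemma quot_cone_archimedean n (x : 'M[V]_n) : mxstar x = x ->
  (forall r : R[i], 0 < r -> quot_cone ((r *: unit_elt)%:M + x)) -> quot_cone x.
Proof.
move=> hx cx; split=> // eps eps0.
have eps20 : 0 < eps / 2 by rewrite divr_gt0.
have [_ /(_ _ eps20) [j Jj cj]] := cx _ eps20.
exists j => //; move: cj; congr (cone _ _); congr (_ + _).
by rewrite addrAC addrC; congr (_ + _); rewrite -raddfD /= -scalerDl -splitr.
Qed.

Lemma quot_cone_sum n I (r : seq I) (F : I -> 'M[V]_n) :
  (forall i, quot_cone (F i)) -> quot_cone (\sum_(i <- r) F i).
Proof.
move=> cF; apply: big_ind => //; last exact: quot_coneD.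
exact/quot_cone_of_cone/cone0.
Qed.

(** The elements to be divided out: since the diagonal of [hpair i j y] vanishes for
    [i] and [j] distinct, its positivity forces [y = 0] when cones are proper.
    Quantifying over all sizes, positions and multipliers makes
    stability under the bimodule operations immediate. *)
Definition null x := forall n (i j : 'I_n) a b,
  quot_cone (hpair i j (ract (lact a x) b)).

Lemma null0 : null 0.
Proof.
by move=> n i j a b; rewrite lact0r ract0l hpair0; exact/quot_cone_of_cone/cone0.
Qed.

Lemma nullD x y : null x -> null y -> null (x + y).
Proof.
by move=> nx ny n i j a b; rewrite lactDr ractDl hpairD; apply: quot_coneD.
Qed.

Lemma null_lact a x : null x -> null (lact a x).
Proof. by move=> nx n i j a' b; rewrite -lactA; exact: nx. Qed.

Lemma null_ract x a : null x -> null (ract x a).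
Proof. by move=> nx n i j a' b; rewrite lact_ract -ractA; exact: nx. Qed.

Lemma null_star x : null x -> null (star x).
Proof.
move=> nx n i j a b.
have := nx n j i (star b) (star a); congr quot_cone.
by rewrite -hpairC star_ract star_lact !starK lact_ract.
Qed.

Lemma nullN x : null x -> null (- x).
Proof. by move=> /(null_lact (-1)); rewrite lactNl lact1. Qed.

Lemma nullZ (c : R[i]) x : null x -> null (c *: x).
Proof. by move=> /(null_lact (c *: 1)); rewrite lactZl lact1. Qed.

Lemma null_subbimod x : J x -> null x.
Proof.
move=> Jx n i j a b; split=> [|eps eps0]; first exact: hpair_herm.
exists (- hpair i j (ract (lact a x) b)) => [k l|].
  have Jy : J (ract (lact a x) b) by apply/subbimod_ract/subbimod_lact.
  rewrite !mxE; apply/subbimodN/subbimodD; case: ifP => _; try exact: subbimod0.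
    exact: Jy.
  exact: subbimod_star.
by rewrite addrAC subrr add0r; apply/cone_unit/ltW.
Qed.

(** An entry [s i j] is isolated by conjugating [s] with a sum of two matrix units
    [P + Q]; the two diagonal terms this creates are conjugates of [s], removed by
    means of [- s]. *)
Lemma null_entries n (s : 'M[V]_n) : quot_cone s -> quot_cone (- s) ->
  forall i j, null (s i j).
Proof.
move=> cs cNs i j m p q a b.
pose P : 'M[A]_(m, n) := emx p i a.
pose Q : 'M[A]_(m, n) := emx q j (star b).
have -> : hpair p q (ract (lact a (s i j)) b) =
    sandwich (P + Q) (P + Q) s + sandwich P P (- s) + sandwich Q Q (- s).
  rewrite !sandwichN !sandwichDl !sandwichDr !sandwich_emx starK.
  rewrite addrAC [X in X - _ - _]addrA addrK.
  rewrite -[X in X - _]addrA [X in X - _]addrC addrK.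
  congr (_ + emx _ _ _).
  by rewrite -[in RHS](cs.1) !mxE star_ract star_lact lact_ract.
by apply: quot_coneD; [apply: quot_coneD|]; apply: quot_cone_sandwich.
Qed.

Lemma null_quot_cone n (x : 'M[V]_n) : mxstar x = x ->
  (forall i j, null (x i j)) -> quot_cone x.
Proof.
move=> hx nx; rewrite (hermitian_sum_hpair hx).
apply: quot_coneZ; first by rewrite invr_ge0.
apply: quot_cone_sum => i; apply: quot_cone_sum => j.
by have := nx i j n i j 1 1; rewrite lact1 ract1.
Qed.

End QuotientCone.

(** * The quotient operator A-system *)

Lemma map_scalar_linear (F : nzRingType) (U W : lmodType F) (f : {linear U -> W})
  n (r : F) u : map_mx f (r *: u)%:M = (r *: f u)%:M :> 'M[W]_n.
Proof. by apply/matrixP => i j; rewrite !mxE raddfMn /= linearZ. Qed.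

Section SystemQuotient.
Local Open Scope quotient_scope.
Variables (R : realType) (A : cstarAlgType R) (V : operatorASystemType A).
Variable J : subbimodule V.
Implicit Types (a b : A) (x y : V).

Definition null_pred : pred V := fun x => `[< null J x >].

Lemma null_predP x : reflect (null J x) (x \in null_pred).
Proof. exact: asboolP. Qed.

Lemma null_zmod_closed : zmod_closed null_pred.
Proof.
split=> [|x y /null_predP nx /null_predP ny]; first exact/null_predP/null0.
by apply/null_predP/nullD => //; apply: nullN.
Qed.

Definition null_submod : zmodClosed V :=
  HB.pack null_pred (GRing.isZmodClosed.Build V null_pred null_zmod_closed).

Definition sysquot : Type := Quotient.quot null_submod.

HB.instance Definition _ := GRing.Zmodule.on sysquot.

Implicit Types q : sysquot.

Definition qpi (x : V) : sysquot := \pi_(Quotient.quot null_submod) x.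
Definition qrepr (q : sysquot) : V := repr (q : Quotient.quot null_submod).

Lemma qreprK q : qpi (qrepr q) = q. Proof. exact: reprK. Qed.

Lemma qpi_eq x y : qpi x = qpi y <-> null J (x - y).
Proof.
have mem_null z : reflect (null J z) (z \in null_submod) by exact: asboolP.
split=> [/eqP|/mem_null]; last by rewrite Quotient.idealrBE => /eqP.
by rewrite /qpi -Quotient.idealrBE => /mem_null.
Qed.

Lemma qpiB : {morph qpi : x y / x - y}.
Proof. by move=> x y; exact: (raddfB (\pi_(Quotient.quot null_submod))). Qed.

HB.instance Definition _ := GRing.isZmodMorphism.Build V sysquot qpi qpiB.

Lemma qpi_eq0 x : qpi x = 0 <-> null J x.
Proof. by rewrite -(raddf0 qpi) qpi_eq subr0. Qed.

Lemma qpi_surj q : exists x, q = qpi x.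
Proof. by exists (qrepr q); rewrite qreprK. Qed.

(** Operations on the quotient are defined through representatives; [qliftE] makes
    them independent of the choice for additive [f] preserving null elements. *)
Definition qlift (f : V -> V) q : sysquot := qpi (f (qrepr q)).

Lemma qliftE (f : V -> V) x : {morph f : x y / x - y} ->
  (forall x, null J x -> null J (f x)) -> qlift f (qpi x) = qpi (f x).
Proof. by move=> fB nf; apply/qpi_eq; rewrite -fB; apply/nf/qpi_eq/qreprK. Qed.

Definition qscale (c : R[i]) := qlift ( *:%R c).
Definition qstar := qlift star.
Definition qlact a := qlift (lact a).
Definition qract q a := qlift (ract^~ a) q.

Lemma qscaleE c x : qscale c (qpi x) = qpi (c *: x).
Proof. by apply: qliftE => [y z|y]; [exact: scalerBr|exact: nullZ]. Qed.

Lemma qstarE x : qstar (qpi x) = qpi (star x).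
Proof. by apply: qliftE => [y z|y]; [exact: starB|exact: null_star]. Qed.

Lemma qlactE a x : qlact a (qpi x) = qpi (lact a x).
Proof.
by apply: qliftE => [y z|y]; [rewrite lactDr lactNr|exact: null_lact].
Qed.

Lemma qractE x a : qract (qpi x) a = qpi (ract x a).
Proof.
by apply: (@qliftE (ract^~ a)) => [y z|y]; [rewrite ractDl ractNl|exact: null_ract].
Qed.

Fact qscaleA c d q : qscale c (qscale d q) = qscale (c * d) q.
Proof. by have [x ->] := qpi_surj q; rewrite !qscaleE scalerA. Qed.

Fact qscale1 q : qscale 1 q = q.
Proof. by have [x ->] := qpi_surj q; rewrite !qscaleE scale1r. Qed.

Fact qscaleDr c : {morph qscale c : p q / p + q}.
Proof.
move=> p q; have [[x ->] [y ->]] := (qpi_surj p, qpi_surj q).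
by rewrite !qscaleE -!raddfD /= qscaleE scalerDr.
Qed.

Fact qscaleDl q : {morph qscale^~ q : c d / c + d}.
Proof.
by move=> c d; have [x ->] := qpi_surj q; rewrite !qscaleE scalerDl raddfD.
Qed.

HB.instance Definition _ := GRing.Zmodule_isLmodule.Build R[i] sysquot
  qscaleA qscale1 qscaleDr qscaleDl.

Lemma qpiZ c x : qpi (c *: x) = c *: qpi x.
Proof. exact/esym/qscaleE. Qed.

HB.instance Definition _ := GRing.isScalable.Build R[i] V sysquot *:%R qpi qpiZ.

Fact qstarD : {morph qstar : p q / p + q}.
Proof.
move=> p q; have [[x ->] [y ->]] := (qpi_surj p, qpi_surj q).
by rewrite !qstarE -!raddfD /= qstarE starD.
Qed.

Fact qstarZ c q : qstar (c *: q) = c^* *: qstar q.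
Proof. by have [x ->] := qpi_surj q; rewrite qstarE -!linearZ /= qstarE starZ. Qed.

Fact qstarK : involutive qstar.
Proof. by move=> q; have [x ->] := qpi_surj q; rewrite !qstarE starK. Qed.

HB.instance Definition _ := isStarModule.Build R sysquot qstarD qstarZ qstarK.

Lemma qpi_star x : qpi (star x) = star (qpi x).
Proof. exact/esym/qstarE. Qed.

Lemma mxstar_qpi m n (x : 'M[V]_(m, n)) :
  mxstar (map_mx qpi x) = map_mx qpi (mxstar x).
Proof. by apply/matrixP => i j; rewrite !mxE qpi_star. Qed.

Lemma mx_qpi_eq0 m n (x : 'M[V]_(m, n)) :
  map_mx qpi x = 0 <-> forall i j, null J (x i j).
Proof.
split=> [/matrixP x0 i j|nx].
  by apply/qpi_eq0; have := x0 i j; rewrite !mxE.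
by apply/matrixP => i j; rewrite !mxE; apply/qpi_eq0.
Qed.

(** A representative of a hermitian matrix is not hermitian in general; its
    hermitian part represents the same matrix. *)
Lemma herm_lift n (q : 'M[sysquot]_n) : mxstar q = q ->
  exists2 x : 'M[V]_n, mxstar x = x & map_mx qpi x = q.
Proof.
move=> hq; pose y := map_mx qrepr q.
have yq : map_mx qpi y = q by apply/matrixP => i j; rewrite !mxE qreprK.
exists (map_mx ( *:%R 2^-1) (y + mxstar y)).
  by rewrite mxstar_scale ?invr_ge0// mxstarD mxstarK addrC.
transitivity (map_mx ( *:%R 2^-1) (q + mxstar q)); last first.
  by rewrite hq; apply/matrixP => i j; rewrite !mxE scale_half_double.
rewrite -yq mxstar_qpi; apply/matrixP => i j.
by rewrite !mxE linearZ /= raddfD.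
Qed.

Definition qcone n (q : 'M[sysquot]_n) : Prop :=
  exists2 x : 'M[V]_n, quot_cone J x & map_mx qpi x = q.

Definition qunit := qpi unit_elt.

Lemma map_qunit n (r : R[i]) :
  map_mx qpi (r *: unit_elt)%:M = (r *: qunit)%:M :> 'M[sysquot]_n.
Proof. exact: map_scalar_linear. Qed.

Fact qcone_herm n (q : 'M[sysquot]_n) : qcone q -> mxstar q = q.
Proof. by case=> x [hx _] <-; rewrite mxstar_qpi hx. Qed.

Fact qconeD n (p q : 'M[sysquot]_n) : qcone p -> qcone q -> qcone (p + q).
Proof.
move=> [x cx <-] [y cy <-]; exists (x + y); first exact: quot_coneD.
by rewrite raddfD.
Qed.

Fact qconeZ n (r : R[i]) (q : 'M[sysquot]_n) :
  0 <= r -> qcone q -> qcone (map_mx ( *:%R r) q).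
Proof.
move=> r0 [x cx <-]; exists (map_mx ( *:%R r) x); first exact: quot_coneZ.
by apply/matrixP => i j; rewrite !mxE linearZ.
Qed.

(** If [x] and [y] represent opposite elements, [x + y] has null entries, so
    subtracting it from [y] shows that [- x] is positive modulo [J]. *)
Fact qcone_proper n (q : 'M[sysquot]_n) : qcone q -> qcone (- q) -> q = 0.
Proof.
move=> [x cx <-] [y cy yx]; apply/mx_qpi_eq0.
apply: null_entries => //.
suff : quot_cone J (y - (x + y)) by rewrite opprD addrCA subrr addr0.
apply: quot_coneD => //; apply: null_quot_cone.
  by rewrite mxstarN mxstarD cx.1 cy.1.
apply/mx_qpi_eq0; rewrite raddfN raddfD /= yx subrr oppr0 //.
Qed.

Definition qsandwich m n (X : 'M[A]_(m, n)) (q : 'M[sysquot]_n) :=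
  \matrix_(i, j) \sum_k \sum_l qract (qlact (X i k) (q k l)) (star (X j l)).

Fact qcone_lact n m (X : 'M[A]_(n, m)) (q : 'M[sysquot]_m) :
  qcone q -> qcone (qsandwich X q).
Proof.
move=> [x cx <-]; exists (sandwich X X x); first exact: quot_cone_sandwich.
apply/matrixP => i j; rewrite !mxE raddf_sum; apply: eq_bigr => k _.
by rewrite raddf_sum; apply: eq_bigr => l _; rewrite /= !mxE qlactE qractE.
Qed.

Fact qcone_conj n m (X : 'M[R[i]]_(n, m)) (q : 'M[sysquot]_m) : qcone q ->
  qcone (\matrix_(i, j) \sum_k \sum_l (X i k * (X j l)^*) *: q k l).
Proof.
move=> /(qcone_lact (map_mx (fun c => c%:A) X)); congr qcone.
apply/matrixP => i j; rewrite !mxE; apply: eq_bigr => k _; apply: eq_bigr => l _.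
have [x ->] := qpi_surj (q k l).
rewrite !mxE qlactE qractE -qpiZ starZ star1 lactZl lact1 ractZr ract1 scalerA.
by rewrite mulrC.
Qed.

Fact qunit_herm : star qunit = qunit.
Proof. by rewrite -qpi_star unit_elt_herm. Qed.

Fact qorder_unit n (q : 'M[sysquot]_n) : mxstar q = q ->
  exists2 r : R[i], 0 < r & qcone ((r *: qunit)%:M - q).
Proof.
move=> /herm_lift[x hx <-]; have [r r0 cr] := order_unit _ _ hx.
exists r => //; exists ((r *: unit_elt)%:M - x); first exact: quot_cone_of_cone.
by rewrite raddfB /= map_qunit.
Qed.

Fact qarchimedean n (q : 'M[sysquot]_n) :
  (forall r : R[i], 0 < r -> qcone ((r *: qunit)%:M + q)) -> qcone q.
Proof.
move=> cq.
have /herm_lift[x hx xq] : mxstar q = q.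
  have := qcone_herm (cq 1 ltr01); rewrite mxstarD -{1}map_qunit mxstar_qpi.
  by rewrite unit_mx_herm// map_qunit => /addrI.
exists x => //; apply: quot_cone_archimedean => // r r0.
have [y cy yq] := cq _ r0.
rewrite -(subrK y (_ + x)) addrC; apply: quot_coneD => //.
apply: null_quot_cone.
  by rewrite mxstarD mxstarN mxstarD hx unit_mx_herm ?ltW// cy.1.
by apply/mx_qpi_eq0; rewrite raddfB raddfD /= yq map_qunit xq subrr.
Qed.

HB.instance Definition _ := isOperatorSystem.Build R sysquot
  qcone_herm qconeD qconeZ qcone_proper qcone_conj qunit_herm qorder_unit
  qarchimedean.

Fact qlactDl a b q : qlact (a + b) q = qlact a q + qlact b q.
Proof. by have [x ->] := qpi_surj q; rewrite !qlactE lactDl raddfD. Qed.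

Fact qlactDr a p q : qlact a (p + q) = qlact a p + qlact a q.
Proof.
have [[x ->] [y ->]] := (qpi_surj p, qpi_surj q).
by rewrite !qlactE -!raddfD /= qlactE lactDr.
Qed.

Fact qlactZl (c : R[i]) a q : qlact (c *: a) q = c *: qlact a q.
Proof. by have [x ->] := qpi_surj q; rewrite !qlactE lactZl linearZ. Qed.

Fact qlactZr (c : R[i]) a q : qlact a (c *: q) = c *: qlact a q.
Proof.
by have [x ->] := qpi_surj q; rewrite qlactE -!qpiZ qlactE lactZr.
Qed.

Fact qlactA a b q : qlact (a * b) q = qlact a (qlact b q).
Proof. by have [x ->] := qpi_surj q; rewrite !qlactE lactA. Qed.

Fact qlact1 q : qlact 1 q = q.
Proof. by have [x ->] := qpi_surj q; rewrite !qlactE lact1. Qed.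

Fact qractDl p q a : qract (p + q) a = qract p a + qract q a.
Proof.
have [[x ->] [y ->]] := (qpi_surj p, qpi_surj q).
by rewrite !qractE -!raddfD /= qractE ractDl.
Qed.

Fact qractDr q a b : qract q (a + b) = qract q a + qract q b.
Proof. by have [x ->] := qpi_surj q; rewrite !qractE ractDr raddfD. Qed.

Fact qractZl (c : R[i]) q a : qract (c *: q) a = c *: qract q a.
Proof.
by have [x ->] := qpi_surj q; rewrite qractE -!qpiZ qractE ractZl.
Qed.

Fact qractZr (c : R[i]) q a : qract q (c *: a) = c *: qract q a.
Proof. by have [x ->] := qpi_surj q; rewrite !qractE ractZr linearZ. Qed.

Fact qractA q a b : qract q (a * b) = qract (qract q a) b.
Proof. by have [x ->] := qpi_surj q; rewrite !qractE ractA. Qed.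

Fact qract1 q : qract q 1 = q.
Proof. by have [x ->] := qpi_surj q; rewrite !qractE ract1. Qed.

Fact qlact_ract a q b : qlact a (qract q b) = qract (qlact a q) b.
Proof. by have [x ->] := qpi_surj q; rewrite !(qlactE, qractE) lact_ract. Qed.

Fact qstar_lact a q : star (qlact a q) = qract (star q) (star a).
Proof.
by have [x ->] := qpi_surj q; rewrite qlactE -!qpi_star qractE star_lact.
Qed.

Fact qlact_unit a : qlact a unit_elt = qract unit_elt a.
Proof. by rewrite qlactE qractE lact_unit. Qed.

HB.instance Definition _ := isOperatorASystem.Build R A sysquot
  qlactDl qlactDr qlactZl qlactZr qlactA qlact1 qractDl qractDr qractZl qractZr
  qractA qract1 qlact_ract qstar_lact qlact_unit qcone_lact.

Lemma qpi_ucp_bimodule_map : ucp_bimodule_map (qpi : {linear V -> sysquot}).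
Proof.
split; first split=> //.
  by move=> n x cx; exists x => //; exact: quot_cone_of_cone.
by move=> a b x; rewrite /= -qractE -qlactE.
Qed.

End SystemQuotient.

Section QuotientUniversal.
Variables (R : realType) (A : cstarAlgType R) (V T : operatorASystemType A).
Variables (J : subbimodule V) (phi : {linear V -> T}).
Hypothesis ucp_phi : ucp_bimodule_map phi.
Hypothesis phiJ : forall x, J x -> phi x = 0.

(** The term in [J] is killed, and the Archimedean property of the target removes
    [eps]. *)
Lemma map_quot_cone n (x : 'M[V]_n) : quot_cone J x -> cone n (map_mx phi x).
Proof.
move: ucp_phi => [[phi1 phicp] _] [_ cx]; apply: archimedean => r /cx[j Jj /phicp].
congr (cone _ _); rewrite !raddfD /= map_scalar_linear phi1.
rewrite [X in _ + X](_ : _ = 0) ?addr0 1?addrC//.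
by apply/matrixP => k l; rewrite !mxE phiJ.
Qed.

(** The image of [hpair 0 1 x] is positive together with its opposite, hence zero
    by properness; its corner entry is [phi x]. *)
Lemma map_null x : null J x -> phi x = 0.
Proof.
move=> nx.
have pair0 : map_mx phi (hpair (0 : 'I_2) 1 x) = 0.
  apply: cone_proper.
    by apply: map_quot_cone; have := nx 2 0 1 1 1; rewrite lact1 ract1.
  rewrite -raddfN; apply: map_quot_cone.
  have := nx 2 0 1 (-1) 1; rewrite lactNl lact1 ract1; congr quot_cone.
  by apply: (addrI (hpair 0 1 x)); rewrite -hpairD !subrr hpair0.
by have /matrixP/(_ 0 1) := pair0; rewrite !mxE /= addr0.
Qed.

Lemma sysquot_lift : exists Psi : {linear sysquot J -> T},
  ucp_bimodule_map Psi /\ forall x, Psi (qpi J x) = phi x.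
Proof.
pose psi (q : sysquot J) := phi (qrepr q).
have psiE x : psi (qpi J x) = phi x.
  apply/eqP; rewrite -subr_eq0 -linearB; apply/eqP/map_null/qpi_eq.
  exact: qreprK.
have psi_lin : linear psi.
  move=> c p q; have [[x ->] [y ->]] := (qpi_surj p, qpi_surj q).
  by rewrite -linearP !psiE linearP.
pose Psi : {linear sysquot J -> T} := HB.pack psi (GRing.isLinear.Build _ _ _ _ psi psi_lin).
exists Psi; split=> //; split; first split.
- by rewrite [LHS]psiE ucp_phi.1.1.
- move=> n q [x cx <-].
  have := map_quot_cone cx; congr (cone _ _).
  by apply/matrixP => i j; rewrite !mxE [RHS]psiE.
- move=> a b q; have [x ->] := qpi_surj q.
  have [_ qb] := qpi_ucp_bimodule_map J.
  by rewrite -qb [LHS]psiE ucp_phi.2 -psiE.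
Qed.

End QuotientUniversal.

(** * The direct sum *)

Section DirectSum.
Variables (R : realType) (A : cstarAlgType R) (S1 S2 : operatorASystemType A).
Implicit Types (a b : A).

Definition dsum : Type := (S1 * S2)%type.
HB.instance Definition _ := GRing.Lmodule.copy dsum (S1 * S2)%type.
Implicit Types x y : dsum.

Definition dfst x : S1 := x.1.
Definition dsnd x : S2 := x.2.

Fact dfst_linear : linear dfst. Proof. by []. Qed.
Fact dsnd_linear : linear dsnd. Proof. by []. Qed.
HB.instance Definition _ := GRing.isLinear.Build R[i] dsum S1 *:%R dfst dfst_linear.
HB.instance Definition _ := GRing.isLinear.Build R[i] dsum S2 *:%R dsnd dsnd_linear.

Lemma dsum_eq x y : dfst x = dfst y -> dsnd x = dsnd y -> x = y.
Proof. by case: x y => [x1 x2] [y1 y2]; rewrite /dfst /dsnd /= => -> ->. Qed.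

Definition dstar x : dsum := (star (dfst x), star (dsnd x)).
Definition dlact a x : dsum := (lact a (dfst x), lact a (dsnd x)).
Definition dract x a : dsum := (ract (dfst x) a, ract (dsnd x) a).
(** Half of the usual unit: the sum [psi1 s + psi2 t] of two unital maps is then
    unital on the direct sum. *)
Definition dunit : dsum := (2^-1 *: unit_elt, 2^-1 *: unit_elt).
Definition dcone n (x : 'M[dsum]_n) : Prop :=
  cone n (map_mx dfst x) /\ cone n (map_mx dsnd x).

Fact dstarD : {morph dstar : x y / x + y}.
Proof. by move=> x y; apply: dsum_eq; exact: starD. Qed.

Fact dstarZ (c : R[i]) x : dstar (c *: x) = c^* *: dstar x.
Proof. by apply: dsum_eq; exact: starZ. Qed.

Fact dstarK : involutive dstar.
Proof. by move=> x; apply: dsum_eq; exact: starK. Qed.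

HB.instance Definition _ := isStarModule.Build R dsum dstarD dstarZ dstarK.

Lemma dsum_mx_eq m n (x y : 'M[dsum]_(m, n)) :
  map_mx dfst x = map_mx dfst y -> map_mx dsnd x = map_mx dsnd y -> x = y.
Proof.
move=> /matrixP xy1 /matrixP xy2; apply/matrixP => i j.
by have := xy1 i j; have := xy2 i j; rewrite !mxE => ? ?; exact: dsum_eq.
Qed.

Lemma map_dfst_star m n (x : 'M[dsum]_(m, n)) :
  map_mx dfst (mxstar x) = mxstar (map_mx dfst x).
Proof. by apply/matrixP => i j; rewrite !mxE. Qed.

Lemma map_dsnd_star m n (x : 'M[dsum]_(m, n)) :
  map_mx dsnd (mxstar x) = mxstar (map_mx dsnd x).
Proof. by apply/matrixP => i j; rewrite !mxE. Qed.

Lemma map_dfst_unit n (r : R[i]) :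
  map_mx dfst (r *: dunit)%:M = ((r / 2) *: unit_elt)%:M :> 'M[S1]_n.
Proof. by rewrite map_scalar_linear /dfst /= scalerA. Qed.

Lemma map_dsnd_unit n (r : R[i]) :
  map_mx dsnd (r *: dunit)%:M = ((r / 2) *: unit_elt)%:M :> 'M[S2]_n.
Proof. by rewrite map_scalar_linear /dsnd /= scalerA. Qed.

Fact dcone_herm n (x : 'M[dsum]_n) : dcone x -> mxstar x = x.
Proof.
move=> [/cone_herm hx1 /cone_herm hx2]; apply: dsum_mx_eq.
  by rewrite map_dfst_star.
by rewrite map_dsnd_star.
Qed.

Fact dconeD n (x y : 'M[dsum]_n) : dcone x -> dcone y -> dcone (x + y).
Proof.
by move=> [x1 x2] [y1 y2]; split; rewrite raddfD; apply: coneD.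
Qed.

Fact dconeZ n (r : R[i]) (x : 'M[dsum]_n) :
  0 <= r -> dcone x -> dcone (map_mx ( *:%R r) x).
Proof.
move=> r0 [/(coneZ _ _ _ r0) x1 /(coneZ _ _ _ r0) x2]; split.
  by move: x1; congr (cone _ _); apply/matrixP => i j; rewrite !mxE.
by move: x2; congr (cone _ _); apply/matrixP => i j; rewrite !mxE.
Qed.

Fact dcone_proper n (x : 'M[dsum]_n) : dcone x -> dcone (- x) -> x = 0.
Proof.
move=> [x1 x2]; rewrite /dcone !raddfN => -[y1 y2].
by apply: dsum_mx_eq; rewrite raddf0; apply: cone_proper.
Qed.

Fact dcone_conj n m (X : 'M[R[i]]_(n, m)) (x : 'M[dsum]_m) : dcone x ->
  dcone (\matrix_(i, j) \sum_k \sum_l (X i k * (X j l)^*) *: x k l).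
Proof.
move=> [/(cone_conj _ _ X) x1 /(cone_conj _ _ X) x2].
split; [move: x1|move: x2]; congr (cone _ _); apply/matrixP => i j;
  rewrite !mxE raddf_sum; apply: eq_bigr => k _; rewrite raddf_sum;
  by apply: eq_bigr => l _; rewrite mxE.
Qed.

Fact dunit_herm : star dunit = dunit.
Proof.
by apply: dsum_eq; rewrite [LHS]starZ unit_elt_herm conj_Creal// ger0_real ?invr_ge0.
Qed.

Fact dorder_unit n (x : 'M[dsum]_n) : mxstar x = x ->
  exists2 r : R[i], 0 < r & dcone ((r *: dunit)%:M - x).
Proof.
move=> hx.
have [|r r0 cr] := @order_unit _ S1 n (map_mx dfst x).
  by rewrite -map_dfst_star hx.
have [|s s0 cs] := @order_unit _ S2 n (map_mx dsnd x).
  by rewrite -map_dsnd_star hx.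
have half : (r + s) * 2 / 2 = r + s by rewrite mulfK ?pnatr_eq0.
exists ((r + s) * 2); first by rewrite mulr_gt0 ?addr_gt0.
split; rewrite raddfB /= ?map_dfst_unit ?map_dsnd_unit half scalerDl raddfD /=.
  by rewrite addrAC; apply: coneD => //; apply/cone_unit/ltW.
by rewrite -addrA; apply: coneD => //; apply/cone_unit/ltW.
Qed.

Fact darchimedean n (x : 'M[dsum]_n) :
  (forall r : R[i], 0 < r -> dcone ((r *: dunit)%:M + x)) -> dcone x.
Proof.
move=> cx; split; apply: archimedean => r r0.
  have [+ _] := cx (r * 2) (mulr_gt0 r0 (ltr0Sn _ 1)).
  by rewrite raddfD /= map_dfst_unit mulfK ?pnatr_eq0.
have [_ +] := cx (r * 2) (mulr_gt0 r0 (ltr0Sn _ 1)).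
by rewrite raddfD /= map_dsnd_unit mulfK ?pnatr_eq0.
Qed.

HB.instance Definition _ := isOperatorSystem.Build R dsum
  dcone_herm dconeD dconeZ dcone_proper dcone_conj dunit_herm dorder_unit
  darchimedean.

Fact dlactDl a b x : dlact (a + b) x = dlact a x + dlact b x.
Proof. by apply: dsum_eq; exact: lactDl. Qed.
Fact dlactDr a x y : dlact a (x + y) = dlact a x + dlact a y.
Proof. by apply: dsum_eq; exact: lactDr. Qed.
Fact dlactZl (c : R[i]) a x : dlact (c *: a) x = c *: dlact a x.
Proof. by apply: dsum_eq; exact: lactZl. Qed.
Fact dlactZr (c : R[i]) a x : dlact a (c *: x) = c *: dlact a x.
Proof. by apply: dsum_eq; exact: lactZr. Qed.
Fact dlactA a b x : dlact (a * b) x = dlact a (dlact b x).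
Proof. by apply: dsum_eq; exact: lactA. Qed.
Fact dlact1 x : dlact 1 x = x.
Proof. by apply: dsum_eq; exact: lact1. Qed.
Fact dractDl x y a : dract (x + y) a = dract x a + dract y a.
Proof. by apply: dsum_eq; exact: ractDl. Qed.
Fact dractDr x a b : dract x (a + b) = dract x a + dract x b.
Proof. by apply: dsum_eq; exact: ractDr. Qed.
Fact dractZl (c : R[i]) x a : dract (c *: x) a = c *: dract x a.
Proof. by apply: dsum_eq; exact: ractZl. Qed.
Fact dractZr (c : R[i]) x a : dract x (c *: a) = c *: dract x a.
Proof. by apply: dsum_eq; exact: ractZr. Qed.
Fact dractA x a b : dract x (a * b) = dract (dract x a) b.
Proof. by apply: dsum_eq; exact: ractA. Qed.
Fact dract1 x : dract x 1 = x.
Proof. by apply: dsum_eq; exact: ract1. Qed.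
Fact dlact_ract a x b : dlact a (dract x b) = dract (dlact a x) b.
Proof. by apply: dsum_eq; exact: lact_ract. Qed.
Fact dstar_lact a x : star (dlact a x) = dract (star x) (star a).
Proof. by apply: dsum_eq; exact: star_lact. Qed.
Fact dlact_unit a : dlact a unit_elt = dract unit_elt a.
Proof. by apply: dsum_eq; rewrite [LHS]lactZr lact_unit -ractZl. Qed.

Fact dcone_lact n m (X : 'M[A]_(n, m)) (x : 'M[dsum]_m) : dcone x ->
  dcone (\matrix_(i, j) \sum_k \sum_l dract (dlact (X i k) (x k l)) (star (X j l))).
Proof.
move=> [/(cone_lact _ _ X) x1 /(cone_lact _ _ X) x2].
split; [move: x1|move: x2]; congr (cone _ _); apply/matrixP => i j;
  rewrite !mxE raddf_sum; apply: eq_bigr => k _; rewrite raddf_sum;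
  by apply: eq_bigr => l _; rewrite mxE.
Qed.

HB.instance Definition _ := isOperatorASystem.Build R A dsum
  dlactDl dlactDr dlactZl dlactZr dlactA dlact1 dractDl dractDr dractZl dractZr
  dractA dract1 dlact_ract dstar_lact dlact_unit dcone_lact.

End DirectSum.

(** * The amalgamated sum *)

Section Coproduct.
Variables (R : realType) (A : cstarAlgType R) (S1 S2 : operatorASystemType A).
Implicit Types (a b : A).

Definition antidiag a : dsum S1 S2 := (lact a unit_elt, - lact a unit_elt).

Definition amalgam : subbimodule (dsum S1 S2).
Proof.
exists (fun x => exists a, x = antidiag a).
- by exists 0; rewrite /antidiag !lact0l oppr0.
- move=> _ _ [a ->] [b ->]; exists (a + b).
  by apply: dsum_eq; rewrite raddfD /dfst /dsnd /= lactDl// opprD.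
- move=> a _ [b ->]; exists (a * b).
  by apply: dsum_eq; rewrite /dfst /dsnd /= ?lactNr lactA.
- move=> _ b [a ->]; exists (a * b).
  by apply: dsum_eq; rewrite /dfst /dsnd /= ?ractNl -lact_ract -lact_unit lactA.
- move=> _ [a ->]; exists (star a).
  by apply: dsum_eq; rewrite /dfst /dsnd /= ?starN star_lact unit_elt_herm lact_unit.
Defined.

Definition coprod := sysquot amalgam.
HB.instance Definition _ := OperatorASystem.on coprod.

Definition inj1 (s : S1) : coprod := qpi amalgam (s, 0).
Definition inj2 (s : S2) : coprod := qpi amalgam (0, s).

Fact inj1_linear : linear inj1.
Proof.
move=> c s t; rewrite -linearP; congr qpi; apply: dsum_eq => //.
by rewrite /dsnd /= scaler0 addr0.
Qed.
Fact inj2_linear : linear inj2.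
Proof.
move=> c s t; rewrite -linearP; congr qpi; apply: dsum_eq => //.
by rewrite /dfst /= scaler0 addr0.
Qed.
HB.instance Definition _ := GRing.isLinear.Build R[i] S1 coprod *:%R inj1 inj1_linear.
HB.instance Definition _ := GRing.isLinear.Build R[i] S2 coprod *:%R inj2 inj2_linear.

Lemma qpi_pair (x : dsum S1 S2) : qpi amalgam x = inj1 x.1 + inj2 x.2.
Proof.
rewrite /inj1 /inj2 -raddfD; congr qpi; case: x => s t; apply: dsum_eq.
  by rewrite /dfst /= addr0.
by rewrite /dsnd /= add0r.
Qed.

(** Unital because [(e1, 0)] and [(e1/2, e2/2)] differ by an element of [amalgam]. *)
Lemma inj1_ucp_bimodule_map : ucp_bimodule_map (inj1 : {linear S1 -> coprod}).
Proof.
split; first split.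
- apply/qpi_eq/null_subbimod; exists (2^-1%:A).
  by apply: dsum_eq; rewrite /dfst /dsnd /= lactZl lact1 ?sub0r ?sub_half.
- move=> n s cs; exists (map_mx (fun t => (t, 0) : dsum S1 S2) s).
    apply: quot_cone_of_cone; split.
      by move: cs; congr (cone _ _); apply/matrixP => i j; rewrite !mxE.
    by have := cone0 S2 n; congr (cone _ _); apply/matrixP => i j; rewrite !mxE.
  by apply/matrixP => i j; rewrite !mxE.
- move=> a b s; rewrite -(qpi_ucp_bimodule_map amalgam).2; congr qpi.
  by apply: dsum_eq; rewrite /dsnd //= lact0r ract0l.
Qed.

Lemma inj2_ucp_bimodule_map : ucp_bimodule_map (inj2 : {linear S2 -> coprod}).
Proof.
split; first split.
- apply/qpi_eq/null_subbimod; exists (- (2^-1%:A)).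
  by apply: dsum_eq; rewrite /dfst /dsnd /= lactNl lactZl lact1 ?sub0r ?opprK ?sub_half.
- move=> n s cs; exists (map_mx (fun t => (0, t) : dsum S1 S2) s).
    apply: quot_cone_of_cone; split.
      by have := cone0 S1 n; congr (cone _ _); apply/matrixP => i j; rewrite !mxE.
    by move: cs; congr (cone _ _); apply/matrixP => i j; rewrite !mxE.
  by apply/matrixP => i j; rewrite !mxE.
- move=> a b s; rewrite -(qpi_ucp_bimodule_map amalgam).2; congr qpi.
  by apply: dsum_eq; rewrite /dfst //= lact0r ract0l.
Qed.

Lemma linear_bimodule_map (S T : operatorASystemType A) (f : {linear S -> T}) :
  bimodule_map f -> forall a s, f (lact a s) = lact a (f s).
Proof. by move=> fb a s; have := fb a 1 s; rewrite !ract1. Qed.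

Lemma coprodP : is_coproduct (inj1 : {linear S1 -> coprod}) (inj2 : {linear S2 -> coprod}).
Proof.
split; [exact: inj1_ucp_bimodule_map|exact: inj2_ucp_bimodule_map|].
move=> T psi1 psi2 [[unit1 cp1] bi1] [[unit2 cp2] bi2].
pose f (x : dsum S1 S2) := psi1 (dfst x) + psi2 (dsnd x).
have f_lin : linear f.
  by move=> c x y; rewrite /f !linearP scalerDr addrACA.
pose phi : {linear dsum S1 S2 -> T} := HB.pack f (GRing.isLinear.Build _ _ _ _ f f_lin).
have phiE s t : phi (s, t) = psi1 s + psi2 t by [].
have phi_ucp : ucp_bimodule_map phi.
  split; first split.
  - by rewrite phiE !linearZ /= unit1 unit2 -scalerDr scale_half_double.
  - move=> n x [/cp1 x1 /cp2 x2]; have := coneD _ _ _ x1 x2; congr (cone _ _).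
    by apply/matrixP => i j; rewrite !mxE.
  - by move=> a b [s t]; rewrite !phiE bi1 bi2 -ractDl -lactDr.
have phiJ x : amalgam x -> phi x = 0.
  case=> a ->; rewrite phiE linearN.
  by rewrite (linear_bimodule_map bi1) (linear_bimodule_map bi2) unit1 unit2 subrr.
have [Psi [Psi_ucp PsiE]] := sysquot_lift phi_ucp phiJ.
exists Psi; split=> //.
- by move=> s; rewrite /= PsiE phiE linear0 addr0.
- by move=> s; rewrite /= PsiE phiE linear0 add0r.
move=> Psi' _ Psi'1 Psi'2 q; have [[s t] ->] := qpi_surj q.
rewrite PsiE phiE qpi_pair linearD.
by have /= -> := Psi'1 s; have /= -> := Psi'2 t.
Qed.

Lemma half_double_real (S : operatorASystemType A) c : star c = c ->
  lact c (2^-1 *: unit_elt) + star (lact c (2^-1 *: unit_elt)) = lact c (unit_elt : S).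
Proof.
move=> hc; rewrite star_lact starZ unit_elt_herm hc conj_Creal ?ger0_real ?invr_ge0//.
by rewrite ractZl -lact_unit -lactZr -lactDr -scalerDr scale_half_double.
Qed.

Section Faithful.
Hypotheses (faithful1 : faithful S1) (faithful2 : faithful S2).

(** The sub-bimodule term [(d e1, - d e2)] enters the two components with opposite
    signs. Faithfulness of [S2] turns positivity of the second component into
    positivity in the algebra, hence in [S1], where the sum of the two components
    no longer involves [d]. *)
Lemma coprod_pos c : star c = c ->
  quot_cone amalgam (hpair (0 : 'I_1) 0 (lact c unit_elt)) ->
  pos (lact c (unit_elt : S1)).
Proof.
move=> hc [_ cc].
have two_pos : pos (lact (c + c) (unit_elt : S1)).
  apply: pos_archimedean => eps eps0.
  have [j Jj [c1 c2]] := cc eps eps0; have [d jE] := Jj 0 0.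
  have {}c1 : pos (lact (c + (eps / 2) *: 1 + d) (unit_elt : S1)).
    move: c1; congr (cone _ _); apply/matrixP => i k; rewrite !ord1 !mxE /=.
    by rewrite half_double_real// jE !lactDl ?lactNl lactZl lact1 scalerA mulr1n.
  have {}c2 : pos (lact (c + (eps / 2) *: 1 - d) (unit_elt : S2)).
    move: c2; congr (cone _ _); apply/matrixP => i k; rewrite !ord1 !mxE /=.
    by rewrite half_double_real// jE !lactDl ?lactNl lactZl lact1 scalerA mulr1n.
  have [b bE] := faithful_pos faithful2 c2.
  have := posD c1 (pos_star_unit S1 b); rewrite -bE -lactDl; congr pos.
  by rewrite addrACA subrr addr0 addrACA -scalerDl -splitr lactDl lactZl lact1 addrC.
have := posZ (_ : 0 <= 2^-1) two_pos; rewrite lactDl scale_half_double; apply.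
by rewrite invr_ge0.
Qed.

(** Multiplying on the left by [a^*] and by [- a^*] makes both [a^* a] and its
    opposite positive on the unit of [S1]. *)
Lemma coprod_faithful : faithful coprod.
Proof.
move=> a; apply: contra_neq.
have -> : lact a (unit_elt : coprod) = qpi amalgam (lact a unit_elt).
  exact: qlactE.
move=> /qpi_eq0 na.
apply: starM_eq0; apply: (faithful_eq0 faithful1); apply: pos_eq0.
  apply: coprod_pos; first by rewrite starM starK.
  by have := na 1 0 0 (star a) 1; rewrite ract1 -lactA.
rewrite -lactNl; apply: coprod_pos; first by rewrite starN starM starK.
by have := na 1 0 0 (- star a) 1; rewrite ract1 -lactA mulNr.
Qed.
End Faithful.

End Coproduct.

(** * Uniqueness and conclusion *)

(** An endomorphism of a coproduct that fixes both inclusions is the identity; apply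
    this to the two composites of the canonical maps. *)
Lemma is_coproduct_iso (R : realType) (A : cstarAlgType R)
    (S1 S2 X Y : operatorASystemType A)
    (phi1 : {linear S1 -> X}) (phi2 : {linear S2 -> X})
    (chi1 : {linear S1 -> Y}) (chi2 : {linear S2 -> Y}) :
  is_coproduct phi1 phi2 -> is_coproduct chi1 chi2 ->
  exists Theta : {linear X -> Y},
    [/\ complete_order_iso Theta, bimodule_map Theta,
        Theta \o phi1 =1 chi1 & Theta \o phi2 =1 chi2].
Proof.
have comp_ucp (S T U : operatorASystemType A) (f : {linear T -> U}) (g : {linear S -> T}) :
    ucp_bimodule_map f -> ucp_bimodule_map g ->
    ucp_bimodule_map (f \o g : {linear S -> U}).
  move=> [[f1 fcp] fb] [[g1 gcp] gb]; split; first split.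
  - by rewrite /= g1 f1.
  - by move=> n s /gcp/fcp; rewrite -map_mx_comp.
  - by move=> a b s; rewrite /= gb fb.
have id_ucp (S : operatorASystemType A) : ucp_bimodule_map (idfun : {linear S -> S}).
  split=> //; split=> // n s cs.
  by move: (cs); congr (cone _ _); apply/matrixP => i j; rewrite mxE.
have comp_id (U : operatorASystemType A) (u1 : {linear S1 -> U}) (u2 : {linear S2 -> U})
    (f : {linear U -> U}) : is_coproduct u1 u2 -> ucp_bimodule_map f ->
    f \o u1 =1 u1 -> f \o u2 =1 u2 -> f =1 id.
  move=> [u1P u2P /(_ U u1 u2 u1P u2P)[F [_ _ _ Funiq]]] fP f1 f2 x.
  by rewrite (Funiq f)// -(Funiq (idfun : {linear U -> U})).
move=> X_coprod Y_coprod.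
have [phi1P phi2P /(_ Y chi1 chi2) X_univ] := X_coprod.
have [chi1P chi2P /(_ X phi1 phi2) Y_univ] := Y_coprod.
have [Th [ThP Th1 Th2 _]] := X_univ chi1P chi2P.
have [Xi [XiP Xi1 Xi2 _]] := Y_univ phi1P phi2P.
exists Th; split=> //; last exact: ThP.2.
split; first exact: ThP.1.2.
exists Xi; split; last exact: XiP.1.2.
- apply: (comp_id _ phi1 phi2 (Xi \o Th : {linear X -> X})) => //.
  + exact: comp_ucp.
  + by move=> s; rewrite -Xi1 /= -Th1.
  + by move=> s; rewrite -Xi2 /= -Th2.
- apply: (comp_id _ chi1 chi2 (Th \o Xi : {linear Y -> Y})) => //.
  + exact: comp_ucp.
  + by move=> s; rewrite -Th1 /= -Xi1.
  + by move=> s; rewrite -Th2 /= -Xi2.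
Qed.

Theorem theorem3p3 (R : realType) (A : cstarAlgType R)
    (S1 S2 : operatorASystemType A) (faithful1 : faithful S1)
    (faithful2 : faithful S2) :
  (exists (X : operatorASystemType A)
          (phi1 : {linear S1 -> X}) (phi2 : {linear S2 -> X}),
      is_coproduct phi1 phi2) /\
  (forall (X : operatorASystemType A)
          (phi1 : {linear S1 -> X}) (phi2 : {linear S2 -> X}),
      is_coproduct phi1 phi2 ->
      faithful X /\
      forall (Y : operatorASystemType A)
             (chi1 : {linear S1 -> Y}) (chi2 : {linear S2 -> Y}),
        is_coproduct chi1 chi2 ->
        exists Theta : {linear X -> Y},
          [/\ complete_order_iso Theta, bimodule_map Theta,
              Theta \o phi1 =1 chi1 & Theta \o phi2 =1 chi2]).
Proof.
have coprod_S := coprodP S1 S2.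
split; first by exists (coprod S1 S2), (@inj1 _ _ S1 S2), (@inj2 _ _ S1 S2).
move=> X phi1 phi2 X_coprod; split; last by move=> Y chi1 chi2; exact: is_coproduct_iso.
have [_ _ /(_ _ _ _ (inj1_ucp_bimodule_map S1 S2) (inj2_ucp_bimodule_map S1 S2))] := X_coprod.
case=> Psi [[[Psi1 _] Psi_bi] _ _ _] a a_neq0.
have := coprod_faithful faithful1 faithful2 a_neq0; apply: contra_neq => aX.
by rewrite -Psi1 -(linear_bimodule_map Psi_bi) aX linear0.
Qed.
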